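(* Let $A$ be an $N\times N$ real matrix that is diagonalizable (over $\mathbb{R}$), let $\tilde\lambda$ be an eigenvalue of $A$, and let $\gamma>0$ with $\gamma\neq-\tilde\lambda$. Let $\mathcal{N}(A-\tilde\lambda I)$ denote the null space of $A-\tilde\lambda I$. 1. If $\mathcal{N}(A-\tilde\lambda I)$ has dimension $1$, then, choosing $x_0\in S^{N-1}$ uniformly at random, with probability $1$ the equation $$(A-\tilde\lambda I+(\gamma+\tilde\lambda)x_0x_0^T)x=\gamma x_0$$ has a unique nonzero solution $\tilde x$, which is an eigenvector of $A$ corresponding to $\tilde\lambda$. 2. If $\mathcal{N}(A-\tilde\lambda I)$ has dimension greater than $1$, then, choosing $x_0\in S^{N-1}$ uniformly at random, with probability $1$ the following holds: for all $\lambda\neq\tilde\lambda$ close enough to $\tilde\lambda$, the equation $$(A-\lambda I+(\gamma+\lambda)x_0x_0^T)x=\gamma x_0$$ has a unique nonzero solution $x_\lambda$, satisfying $$\eta_1|\lambda-\tilde\lambda|<\|x_\lambda-\tilde x\|<\eta_2|\lambda-\tilde\lambda|$$ for some $0<\eta_1<\eta_2<\infty$, where $\tilde x\in\mathcal{N}(A-\tilde\lambda I)$ is uniquely determined by $x_0$ and $\eta_1,\eta_2$ do not depend on $\lambda$.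
   Context: $S^{N-1}$ is the Euclidean unit sphere in $\mathbb{R}^N$, $\|\cdot\|$ the Euclidean norm, and vectors are column vectors.
   Formalization: In part 2 the lower bound η₁|λ−λ̃| < ‖x_λ−x̃‖ is claimed only when A ≠ λ̃I; for A = λ̃I the solution x_λ = γx₀/(γ+λ̃) does not depend on λ, so the lower bound is false there. *)

(* Defs.v *)
From HB Require Import structures.
From mathcomp Require Import all_boot all_order all_algebra.
From mathcomp Require Import all_classical all_reals all_analysis.

Set Implicit Arguments.
Unset Strict Implicit.
Unset Printing Implicit Defensive.

Import Order.TTheory GRing.Theory Num.Theory.
Import numFieldNormedType.Exports.

Local Open Scope classical_set_scope.
Local Open Scope ring_scope.

(* The library norm `|x| on matrices is the max norm, hence a separate
   Euclidean norm. *)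
Definition enorm (R : realType) (N : nat) (x : 'cV[R]_N) : R :=
  Num.sqrt (\sum_(i < N) x i 0 ^+ 2).

Definition esphere (R : realType) (N : nat) : set 'cV[R]_N :=
  [set x | enorm x = 1].

(* R^N with its Borel sigma-algebra. *)
Definition borel_cV (R : realType) (N : nat) :=
  g_sigma_algebraType (@open 'cV[R]_N).

(* The uniform distribution on the unit sphere of R^N, as a Borel measure on
   R^N: the unique probability measure that is carried by the sphere and is
   invariant under the orthogonal group O(N).  O(N) rather than SO(N) is needed
   for N = 1, where it gives mass 1/2 to each of the two points. *)
Definition uniform_on_sphere (R : realType) (N : nat)
    (sigma : probability (borel_cV R N) R) : Prop :=
  sigma (@esphere R N) = 1%:E /\
  forall Q : 'M[R]_N, Q^T *m Q = 1%:M ->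
  forall B : set (borel_cV R N), measurable B ->
    sigma [set x | B (Q *m x)] = sigma B.

(* Vectors are columns: this is {x | M *m x = 0}, whereas kermx is the row
   kernel. *)
Definition nullspace (R : realType) (N : nat) (M : 'M[R]_N) :
    {vspace 'cV[R]_N} :=
  lker (linfun (mulmx M : 'cV[R]_N -> 'cV[R]_N)).

Definition eigenvector (R : realType) (N : nat) (A : 'M[R]_N) (lambda : R)
    (x : 'cV[R]_N) : Prop :=
  x != 0 /\ A *m x = lambda *: x.

Definition shifted_mx (R : realType) (N : nat) (A : 'M[R]_N) (gamma lambda : R)
    (x0 : 'cV[R]_N) : 'M[R]_N :=
  A - lambda%:M + (gamma + lambda) *: (x0 *m x0^T).

Definition unique_nonzero_solution (R : realType) (N : nat) (A : 'M[R]_N)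
    (gamma lambda : R) (x0 x : 'cV[R]_N) : Prop :=
  unique (fun y : 'cV[R]_N =>
    y != 0 /\ shifted_mx A gamma lambda x0 *m y = gamma *: x0) x.

(* Main.v *)
Require Import Defs.
From HB Require Import structures.
From mathcomp Require Import all_boot all_order all_algebra.
From mathcomp Require Import all_classical all_reals all_analysis.
From mathcomp Require Import ring lra.

Set Implicit Arguments.
Unset Strict Implicit.
Unset Printing Implicit Defensive.

Import Order.TTheory GRing.Theory Num.Theory.
Import numFieldNormedType.Exports.

Local Open Scope classical_set_scope.
Local Open Scope ring_scope.

(** Write B = A - mu, mu the eigenvalue, and let Pi be the spectral projection
    of A on the eigenspace of mu.  Everything is governed by the number
    a = x0^T Pi x0, and, for the lower bound, by (1 - Pi) x0.

    If a != 0, part 1 is elementary (eigenline_solution): Pi applied to the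
    equation gives x0^T x = gamma / (gamma + mu), so B x = 0, and x is the
    multiple of Pi x0 with that scalar product.  For part 2, A - l is
    invertible for l close to mu and distinct from it, and its inverse is a
    simple pole - Pi / (l - mu) plus a term S l continuous at mu.  Solving the
    rank-one perturbation explicitly shows x_l = xt + (l - mu) g l with g
    continuous at mu (perturbed_solution), hence the upper bound.  The
    component of g mu outside the eigenspace vanishes only if
    (1 - Pi) x0 = 0, hence the lower bound when this vector is nonzero.

    It remains to see that almost surely a != 0 and, if A is not scalar,
    (1 - Pi) x0 != 0.  Both follow from one fact, applied to the nonzero
    idempotents Pi and 1 - Pi: the zero set of a nonzero quadratic form is
    null (negligible_quadric).  The measure is known only through its
    invariance under O(N), so this is proved by overlap counting: infinitely
    many isometric copies of the zero set have the same measure, and if almost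
    every point lies in finitely many of them, this measure is 0
    (null_of_finite_overlap).  The copies are images under reflections along
    e_i + n e_j; for a fixed point x, whether x lies in the copy of index n is
    a polynomial condition of degree at most 4 on n, trivial only if
    x_i = x_j = 0, as soon as the form is not scalar on the plane (i, j).
    Coordinate subspaces are themselves zero sets of forms sum x_k^2, so the
    exceptional set is dealt with by induction on codimension. *)

(** * Null sets by finite overlap *)

(** Reverse Fatou for sets: in a probability space the limsup of the F n has
    measure at least limsup of mu (F n), here c; but up to E no point lies in
    infinitely many F n. *)
Lemma null_of_finite_overlap d (T : measurableType d) (R : realType)
    (mu : probability T R) (F : (set T)^nat) (E : set T) (c : \bar R) :
  (forall n, measurable (F n)) -> (forall n, mu (F n) = c) ->
  measurable E -> mu E = 0%E ->
  (forall x, ~ E x -> exists m, forall n, (m <= n)%N -> ~ F n x) ->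
  c = 0%E.
Proof.
move=> mF Fc mE E0 FE.
have c0 : (0 <= c)%E by rewrite -(Fc 0%N).
apply/eqP; rewrite eq_le c0 andbT.
have mU k : measurable (\bigcup_(j in [set j | (k <= j)%N]) F j).
  by apply: bigcup_measurable.
have mL : measurable (lim_sup_set F) by apply: bigcapT_measurable.
have L0 : mu (lim_sup_set F) = 0%E.
  apply: (subset_measure0 mL mE _ E0) => x Lx.
  apply: contrapT => /FE[m mP]; have [j /= mj Fj] := Lx m I.
  exact: mP mj Fj.
have /cvg_lim <- // :
    mu (\bigcup_(j in [set j | (k <= j)%N]) F j) @[k --> \oo] --> 0%E.
  rewrite -L0; apply: lim_sup_set_cvg => //.
  by rewrite (le_lt_trans (probability_le1 mu (mU 0%N))) ?ltry.
apply: lime_ge.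
  by apply/cvg_ex; exists (mu (lim_sup_set F)); apply: lim_sup_set_cvg => //;
    rewrite (le_lt_trans (probability_le1 mu (mU 0%N))) ?ltry.
apply: nearW => k; rewrite -(Fc k) le_measure ?inE//.
by apply: bigcup_sup => /=.
Qed.

(** Used to produce finite overlap: a parameter n is bad for a point only if
    it is a root of the polynomial attached to that point. *)
Lemma finite_nat_roots (R : numDomainType) (p : {poly R}) : p != 0 ->
  exists m, forall n, (m <= n)%N -> ~~ root p n%:R.
Proof.
have [k] := ubnP (size p); elim: k p => // k IHk p ltk p0.
have [[a ra]|nr] := pselect (exists a : nat, root p a%:R); last first.
  by exists 0%N => n _; apply/negP => rn; apply: nr; exists n.
have [q pE] := factor_theorem _ _ ra.
have q0 : q != 0 by apply: contra_neq p0 => q0; rewrite pE q0 mul0r.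
have [|m mP] := IHk q _ q0.
  by move: ltk; rewrite pE size_Mmonic ?monicXsubC// size_XsubC addn2.
exists (maxn m a.+1) => n; rewrite geq_max => /andP[mn an].
by rewrite pE rootM negb_or mP// root_XsubC eqr_nat gtn_eqF.
Qed.

Definition bform (R : realType) N (S : 'M[R]_N) (x y : 'cV[R]_N) : R :=
  (x^T *m S *m y) 0 0.

Lemma bformDl (R : realType) N (S : 'M[R]_N) x y z (a : R) :
  bform S (x + a *: y) z = bform S x z + a * bform S y z.
Proof.
rewrite /bform [(x + _)^T]linearD /= [(a *: y)^T]linearZ /= 2!mulmxDl.
by rewrite -!scalemxAl !mxE.
Qed.

Lemma bformDr (R : realType) N (S : 'M[R]_N) x y z (a : R) :
  bform S x (y + a *: z) = bform S x y + a * bform S x z.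
Proof. by rewrite /bform mulmxDr -scalemxAr !mxE. Qed.

Lemma bformZr (R : realType) N (M : 'M[R]_N) x y a :
  bform M x (a *: y) = a * bform M x y.
Proof. by rewrite /bform -scalemxAr mxE. Qed.

Lemma bform_mulmx (R : realType) N (M : 'M[R]_N) x y :
  bform 1%:M x (M *m y) = bform M x y.
Proof. by rewrite /bform mulmx1 mulmxA. Qed.

Lemma bformC (R : realType) N (S : 'M[R]_N) x y : S^T = S ->
  bform S x y = bform S y x.
Proof.
move=> Ss; rewrite /bform -[in LHS](trmxK (x^T *m S *m y)) [LHS]mxE.
by rewrite !trmx_mul trmxK Ss mulmxA.
Qed.

Lemma bform_delta (R : realType) N (S : 'M[R]_N) i j :
  bform S (delta_mx i 0) (delta_mx j 0) = S i j.
Proof. by rewrite /bform trmx_delta -rowE -colE !mxE. Qed.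

Lemma bform1_delta (R : realType) N (x : 'cV[R]_N) i :
  bform 1%:M (delta_mx i 0) x = x i 0.
Proof. by rewrite /bform trmx_delta mulmx1 -rowE mxE. Qed.

Definition quadric (R : realType) N (S : 'M[R]_N) : set (borel_cV R N) :=
  [set x : 'cV[R]_N | bform S x x = 0].

(** * Quadrics and plane reflections *)

Lemma cvg_fin_sum (R : realType) (T : Type) (F : set_system T)
    (I : finType) (f : I -> T -> R) (l : I -> R) : Filter F ->
  (forall i, f i x @[x --> F] --> l i) ->
  \sum_i f i x @[x --> F] --> \sum_i l i.
Proof.
by move=> FF fl; apply: cvg_big => [|i _]; [exact: add_continuous|exact: fl].
Qed.

Lemma continuous_bform_diag (R : realType) N (S : 'M[R]_N) :
  continuous (fun x => bform S x x).
Proof.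
have -> : (fun x => bform S x x) =
    fun x => \sum_i (\sum_j x j 0 * S j i) * x i 0.
  apply/funext => x; rewrite /bform mxE; apply: eq_bigr => i _.
  by rewrite mxE; congr (_ * _); apply: eq_bigr => j _; rewrite mxE.
move=> x; have Fx : Filter (nbhs x) := nbhs_filter x.
apply: (cvg_fin_sum (l := fun i => (\sum_j x j 0 * S j i) * x i 0) Fx) => i.
apply: cvgM; last exact: coord_continuous.
apply: (cvg_fin_sum (l := fun j => x j 0 * S j i) Fx) => j.
by apply: cvgM; [exact: coord_continuous|exact: cvg_cst].
Qed.

Lemma measurable_closed_cV (R : realType) N (A : set 'cV[R]_N) :
  closed A -> measurable (A : set (borel_cV R N)).
Proof.
move=> cA; rewrite -[A]setCK; apply: measurableC.
by apply: sub_sigma_algebra; exact: closed_openC.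
Qed.

Lemma measurable_quadric (R : realType) N (S : 'M[R]_N) :
  measurable (quadric S).
Proof.
apply: measurable_closed_cV.
apply: (@preimage_closed _ _ (fun x => bform S x x) [set 0]).
  by move=> x _; exact: continuous_bform_diag.
exact: closed_eq.
Qed.

(** The Householder reflection in the hyperplane orthogonal to u. *)
Definition reflector (R : realType) N (u : 'cV[R]_N) : 'M[R]_N :=
  1%:M - (2 / bform 1%:M u u) *: (u *m u^T).

Lemma reflectorE (R : realType) N (u x : 'cV[R]_N) :
  reflector u *m x = x + (- (2 / bform 1%:M u u) * bform 1%:M u x) *: u.
Proof.
rewrite mulmxBl mul1mx -scalemxAl -mulmxA [u^T *m x]mx11_scalar mul_mx_scalar.
by rewrite scalerA mulNr scaleNr /bform !mulmx1.
Qed.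

Lemma reflector_orthogonal (R : realType) N (u : 'cV[R]_N) :
  bform 1%:M u u != 0 -> (reflector u)^T *m reflector u = 1%:M.
Proof.
move=> u0; have -> : (reflector u)^T = reflector u.
  by rewrite /reflector linearB linearZ /= trmx1 trmx_mul trmxK.
rewrite {1}/reflector mulmxBl mul1mx -scalemxAl -mulmxA.
have -> : u^T *m reflector u = - u^T.
  rewrite /reflector mulmxBr mulmx1 -scalemxAr mulmxA.
  rewrite [u^T *m u]mx11_scalar mul_scalar_mx scalerA.
  have -> : (u^T *m u) 0 0 = bform 1%:M u u.
    by rewrite /bform mulmx1.
  rewrite -mulrA mulVf// mulr1 scaler_nat mulr2n opprD addrA subrr.
  by rewrite add0r.
by rewrite mulmxN scalerN opprK subrK.
Qed.

(** As t runs over the naturals, the reflections along these vectors move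
    only the coordinates i and j, and do so in infinitely many ways. *)
Definition plane_vec (R : realType) N (i j : 'I_N) (t : R) : 'cV[R]_N :=
  delta_mx i 0 + t *: delta_mx j 0.

(** The value of the form S at the reflection of x along plane_vec i j t, as a
    function of t and cleared of its denominator (1 + t^2)^2. *)
Definition reflection_quartic (R : realType) N (S : 'M[R]_N) i j (x : 'cV[R]_N)
    : {poly R} :=
  (1 + 'X^2) ^+ 2 * (bform S x x)%:P
  - 4%:R%:P * (1 + 'X^2) * ((x i 0)%:P + (x j 0)%:P * 'X)
      * ((bform S x (delta_mx i 0))%:P + (bform S x (delta_mx j 0))%:P * 'X)
  + 4%:R%:P * ((x i 0)%:P + (x j 0)%:P * 'X) ^+ 2
      * ((S i i)%:P + (2 * S i j)%:P * 'X + (S j j)%:P * 'X^2).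

Lemma plane_vec_norm (R : realType) N (i j : 'I_N) (t : R) : i != j ->
  bform 1%:M (plane_vec i j t) (plane_vec i j t) = 1 + t ^+ 2.
Proof.
move=> ij; rewrite /plane_vec bformDl !bformDr !bform_delta !mxE !eqxx.
by rewrite [j == i]eq_sym (negbTE ij) /= mulr1n mulr0n; ring.
Qed.

Lemma reflection_quarticE (R : realType) N (S : 'M[R]_N) i j x (t : R) :
  S^T = S -> i != j ->
  (reflection_quartic S i j x).[t] =
  (1 + t ^+ 2) ^+ 2 * bform S (reflector (plane_vec i j t) *m x)
                         (reflector (plane_vec i j t) *m x).
Proof.
move=> Ss ij; have t0 : 1 + t ^+ 2 != 0 by rewrite gt_eqF// ltr_wpDr ?sqr_ge0.
rewrite reflectorE plane_vec_norm//.
have -> : bform 1%:M (plane_vec i j t) x = x i 0 + t * x j 0.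
  by rewrite /plane_vec bformDl !bform1_delta.
rewrite /plane_vec !(bformDl, bformDr) !bform_delta.
rewrite ![bform S (delta_mx _ _) x]bformC//.
have -> : S j i = S i j by rewrite -[in LHS]Ss mxE.
rewrite /reflection_quartic.
rewrite !(hornerD, hornerN, hornerM, hornerC, hornerX, horner_exp, hornerXn).
by field.
Qed.

(** At t = sqrt (-1) the factor 1 + t^2 vanishes and the quartic takes the value
    4 (x_i + t x_j)^2 (S_ii - S_jj + 2 t S_ij), a product of complex numbers of
    which the last is nonzero.  Its real and imaginary parts are f0 - f2 + f4
    and f1 - f3 in terms of the coefficients f_k, so they can be reached through
    real evaluations at five points. *)
Lemma reflection_quartic_eq0 (R : realType) N (S : 'M[R]_N) i j x :
  (S i j != 0) || (S i i != S j j) -> reflection_quartic S i j x = 0 ->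
  x i 0 = 0 /\ x j 0 = 0.
Proof.
move=> Sij p0; pose p t := (reflection_quartic S i j x).[t].
have pE t : p t = 0 by rewrite /p p0 horner0.
have := pE 0; have := pE 1; have := pE (-1); have := pE 2; have := pE (-2).
rewrite /p /reflection_quartic.
rewrite !(hornerD, hornerN, hornerM, hornerC, hornerX, horner_exp, hornerXn).
move: (bform S x x) (bform S x _) (bform S x _) => q0 bi bj.
move: (x i 0) (x j 0) (S i i) (S i j) (S j j) Sij => a b s c s' Sij.
move=> e1 e2 e3 e4 e5.
(* Real and imaginary parts of the value at sqrt (-1). *)
have eU : (s - s') * (a ^+ 2 - b ^+ 2) = 2 * c * (2 * a * b) by lra.
have eV : 2 * c * (a ^+ 2 - b ^+ 2) = - (s - s') * (2 * a * b) by lra.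
(* Multiplicativity of the squared modulus. *)
have W : ((s - s') ^+ 2 + (2 * c) ^+ 2) * (a ^+ 2 + b ^+ 2) ^+ 2 = 0.
  transitivity (((s - s') * (a ^+ 2 - b ^+ 2) - 2 * c * (2 * a * b)) ^+ 2 +
     (2 * c * (a ^+ 2 - b ^+ 2) + (s - s') * (2 * a * b)) ^+ 2); first by ring.
  by rewrite eU eV; ring.
have D0 : (s - s') ^+ 2 + (2 * c) ^+ 2 != 0.
  rewrite paddr_eq0 ?sqr_ge0// !sqrf_eq0 mulf_eq0 pnatr_eq0/= subr_eq0.
  by rewrite negb_and orbC.
move/eqP: W; rewrite mulf_eq0 (negbTE D0)/= sqrf_eq0 paddr_eq0 ?sqr_ge0//.
by rewrite !sqrf_eq0 => /andP[/eqP-> /eqP->].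
Qed.

Lemma measurable_esphere (R : realType) N :
  measurable (@esphere R N : set (borel_cV R N)).
Proof.
apply: measurable_closed_cV.
have -> : @esphere R N = (fun x => bform 1%:M x x) @^-1` [set 1].
  apply/funext => x; apply/propext; rewrite /esphere/= /enorm.
  have -> : bform 1%:M x x = \sum_i x i 0 ^+ 2.
    by rewrite /bform mulmx1 mxE; apply: eq_bigr => i _; rewrite mxE expr2.
  split=> [e1|->]; last by rewrite sqrtr1.
  by rewrite -(sqr_sqrtr (sumr_ge0 _ (fun i _ => sqr_ge0 (x i 0)))) e1 expr1n.
apply: preimage_closed; last exact: closed_eq.
by move=> x _; exact: continuous_bform_diag.
Qed.

(** * Quadrics are null for the uniform measure *)

(** By invariance all preimages of the quadric under the reflections along
    plane_vec i j n have the measure of the quadric.  A point with a nonzero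
    quartic lies in finitely many of them; a point with a zero quartic has
    x_i = x_j = 0 and lies on the quadric, hence in the null set of the last
    hypothesis. *)
Lemma negligible_quadric_of_plane (R : realType) N
    (sigma : probability (borel_cV R N) R) (S : 'M[R]_N) i j :
  uniform_on_sphere sigma ->
  S^T = S -> i != j -> (S i j != 0) || (S i i != S j j) ->
  sigma.-negligible (quadric S `&` [set x | x i 0 = 0 /\ x j 0 = 0]) ->
  sigma.-negligible (quadric S).
Proof.
move=> sigma_unif Ss ij Sij [E [mE E0 subE]]; have [_ invO] := sigma_unif.
have mS := measurable_quadric S; apply/negligibleP => //.
pose H n := reflector (plane_vec i j n%:R : 'cV[R]_N).
have oH n : (H n)^T *m H n = 1%:M.
  apply: reflector_orthogonal.
  by rewrite plane_vec_norm// gt_eqF// ltr_wpDr ?sqr_ge0.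
have HE n : [set x | quadric S (H n *m x)] = quadric ((H n)^T *m S *m H n).
  by apply/funext => x; rewrite /quadric /bform/= trmx_mul !mulmxA.
have := @null_of_finite_overlap _ _ _ sigma
  (fun n => [set x | quadric S (H n *m x)]) E (sigma (quadric S)).
apply=> // [n|n|x nEx].
- by rewrite HE; exact: measurable_quadric.
- exact: invO.
have p0 : reflection_quartic S i j x != 0.
  apply/eqP => p0; apply: nEx; apply: subE.
  have [xi xj] := reflection_quartic_eq0 Sij p0; split => //.
  (* At n = 0 the quartic is the value of the form at x itself. *)
  have := horner0 (0 : R); rewrite -p0 /reflection_quartic xi xj.
  rewrite !(hornerD, hornerN, hornerM, hornerC, hornerX, horner_exp, hornerXn).
  by rewrite /quadric/= => <-; ring.
have [m mP] := finite_nat_roots p0; exists m => n /mP /negP + Fn; apply.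
apply/rootP; rewrite reflection_quarticE//.
by move: Fn; rewrite /quadric/= => ->; rewrite mulr0.
Qed.

(** The form sum_(k in X) x_k^2, whose zero set is a coordinate subspace. *)
Definition coord_mx (R : realType) N (X : {set 'I_N}) : 'M[R]_N :=
  diag_mx (\row_k (k \in X)%:R).

Lemma bform_coord_mx (R : realType) N (X : {set 'I_N}) (x : 'cV[R]_N) :
  bform (coord_mx R X) x x = \sum_(k in X) x k 0 ^+ 2.
Proof.
rewrite /bform /coord_mx mul_mx_diag mxE [RHS]big_mkcond; apply: eq_bigr => k _.
by rewrite !mxE; case: ifP => _; rewrite ?mulr1 ?mulr0 ?mul0r ?expr2.
Qed.

Lemma quadric_coord_mx (R : realType) N (X : {set 'I_N}) (x : 'cV[R]_N) :
  quadric (coord_mx R X) x <-> forall k, k \in X -> x k 0 = 0.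
Proof.
rewrite /quadric/= bform_coord_mx; split=> [/eqP|x0]; last first.
  by apply: big1 => k /x0 ->; rewrite expr0n.
rewrite psumr_eq0 => [/allP x0 k kX|k _]; last exact: sqr_ge0.
by have := x0 k (mem_index_enum k); rewrite kX sqrf_eq0 => /eqP.
Qed.

(** Downward induction on X: for i in X and j outside, the form of X is not
    scalar on the plane (i, j), and its exceptional set is the subspace of
    j |: X.  The induction ends at the origin, which is off the sphere. *)
Lemma negligible_coord_subspace (R : realType) N
    (sigma : probability (borel_cV R N) R) (X : {set 'I_N}) i :
  uniform_on_sphere sigma -> i \in X ->
  sigma.-negligible (quadric (coord_mx R X)).
Proof.
move=> sigma_unif; have [k] := ubnP #|(~: X)%SET|.
elim: k X i => // k IHk X i ltk iX.
have [->|XT] := eqVneq X finset.setT.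
  have [sph _] := sigma_unif.
  exists (~` (@esphere R N)); split.
    by apply: measurableC; exact: measurable_esphere.
    by rewrite probability_setC ?sph ?subee//; exact: measurable_esphere.
  move=> x /quadric_coord_mx x0; rewrite /esphere/= /enorm big1 ?sqrtr0.
    by move/eqP; rewrite eq_sym oner_eq0.
  by move=> l _; rewrite x0 ?inE// expr0n.
have /subsetPn[j _ jX] : ~~ (finset.setT \subset X) by rewrite finset.subTset.
have ij : i != j by apply: contraNneq jX => <-.
apply: (negligible_quadric_of_plane (i := i) (j := j)) => //.
- by rewrite /coord_mx tr_diag_mx.
- by rewrite !mxE iX (negbTE jX) !eqxx mulr1n mulr0n oner_eq0 orbT.
apply: negligibleS (IHk (j |: X)%SET j _ _).
- move=> x [/quadric_coord_mx Xx [_ xj]]; apply/quadric_coord_mx => l.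
  by rewrite !inE => /predU1P[->|/Xx].
- rewrite -ltnS; apply: leq_trans ltk; apply: proper_card.
  rewrite properE finset.setCS finset.subsetUr/=.
  by apply/subsetPn; exists j; rewrite !inE ?eqxx.
- by rewrite !inE eqxx.
Qed.

(** If S is scalar on every coordinate plane it is a nonzero multiple of the
    identity and vanishes only at the origin; otherwise the exceptional set of
    negligible_quadric_of_plane lies in a coordinate hyperplane. *)
Lemma negligible_quadric (R : realType) N (sigma : probability (borel_cV R N) R)
    (S : 'M[R]_N) :
  uniform_on_sphere sigma -> S^T = S -> S != 0 ->
  sigma.-negligible (quadric S).
Proof.
move=> sigma_unif Ss S0.
have [[i [j [ij Sij]]]|scal] :=
    pselect (exists i j, i != j /\ (S i j != 0) || (S i i != S j j)).
  apply: (negligible_quadric_of_plane sigma_unif Ss ij) => //.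
  apply: negligibleS (negligible_coord_subspace (X := [set i]%SET)
    (i := i) sigma_unif _).
    move=> x [_ [xi _]]; apply/quadric_coord_mx => k.
    by rewrite inE => /eqP->.
  by rewrite inE.
have off i j : i != j -> S i j = 0 /\ S i i = S j j.
  move=> ij; have /negP : ~ ((S i j != 0) || (S i i != S j j)).
    by move=> Sij; apply: scal; exists i, j.
  by rewrite negb_or !negbK => /andP[/eqP ? /eqP ?].
have /matrix0Pn[i [j Sij]] := S0.
have ij : i = j by apply: contraNeq Sij => /off[-> _].
rewrite -{}ij in Sij; have SE : S = (S i i)%:M.
  apply/matrixP => k l; rewrite mxE; have [->|/off[-> _]//] := eqVneq k l.
  by have [->//|/off[_ ->]] := eqVneq l i.
apply: negligibleS (negligible_coord_subspace (X := finset.setT)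
  (i := i) sigma_unif _).
  move=> x.
  have -> : coord_mx R finset.setT = (S i i)^-1 *: S.
    rewrite {2}SE scale_scalar_mx mulVf//; apply/matrixP => k l.
    by rewrite !mxE inE.
  rewrite /quadric/= /bform -scalemxAr -scalemxAl => x0.
  by rewrite mxE x0 mulr0.
by rewrite inE.
Qed.

(** P has the same quadratic form as half of P + P^T.  An antisymmetric
    idempotent is zero: P = P P = P^T P^T = (P P)^T = P^T = - P. *)
Lemma ae_idempotent_form_neq0 (R : realType) N
    (sigma : probability (borel_cV R N) R) (P : 'M[R]_N) :
  uniform_on_sphere sigma -> P *m P = P -> P != 0 ->
  \forall x \ae sigma, bform P x x != 0.
Proof.
move=> sigma_unif PP P0.
apply: negligibleS (negligible_quadric (S := P + P^T) sigma_unif _ _).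
- move=> x /= /negP; rewrite negbK => /eqP qx.
  rewrite /quadric/= /bform mulmxDr mulmxDl mxE -/(bform P x x) qx add0r.
  have -> : x^T *m P^T *m x = (x^T *m P *m x)^T.
    by rewrite !trmx_mul trmxK mulmxA.
  by rewrite mxE.
- by rewrite linearD /= trmxK addrC.
apply: contra_neq P0 => /eqP; rewrite addr_eq0 => /eqP PE.
have : P *m P = P^T *m P^T by rewrite {1 2}PE mulNmx mulmxN opprK.
rewrite -trmx_mul PP => PT; move/eqP: PE; rewrite -PT -addr_eq0.
by rewrite -mulr2n -scaler_nat scaler_eq0 pnatr_eq0 => /eqP.
Qed.

(** * Spectral projection and reduced resolvent *)

(** f (A) for a matrix A diagonal in the basis P, f being given by its values
    at the eigenvalues: with P fixed, these matrices form a commutative algebra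
    isomorphic to that of functions on indices. *)
Definition diag_fun (R : realType) N (P : 'M[R]_N) (f : 'I_N -> R) : 'M[R]_N :=
  invmx P *m diag_mx (\row_k f k) *m P.

Lemma diag_funM (R : realType) N (P : 'M[R]_N) f g : P \in unitmx ->
  diag_fun P f *m diag_fun P g = diag_fun P (fun k => f k * g k).
Proof.
move=> Pu; rewrite /diag_fun !mulmxA mulmxK// -[_ *m _ *m diag_mx _]mulmxA.
rewrite mulmx_diag; congr (_ *m diag_mx _ *m _).
by apply/rowP => k; rewrite !mxE.
Qed.

Lemma diag_fun_cst (R : realType) N (P : 'M[R]_N) c : P \in unitmx ->
  diag_fun P (fun=> c) = c%:M.
Proof.
move=> Pu; have rE : \row__ c = const_mx c :> 'rV[R]_N.
  by apply/rowP => k; rewrite !mxE.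
rewrite /diag_fun rE diag_const_mx mul_mx_scalar -scalemxAl mulVmx//.
by rewrite scalemx1.
Qed.

Lemma diag_funB (R : realType) N (P : 'M[R]_N) f g :
  diag_fun P (fun k => f k - g k) = diag_fun P f - diag_fun P g.
Proof.
rewrite /diag_fun -mulmxBl -mulmxBr -linearB.
by congr (_ *m diag_mx _ *m _); apply/rowP => k; rewrite !mxE.
Qed.

Lemma cvg_diag_fun (R : realType) N (P : 'M[R]_N) (h : R -> 'I_N -> R) mu i j :
  (forall k, h l k @[l --> mu] --> h mu k) ->
  diag_fun P (h l) i j @[l --> mu] --> diag_fun P (h mu) i j.
Proof.
move=> hc.
have E l : diag_fun P (h l) i j = \sum_k invmx P i k * h l k * P k j.
  by rewrite /diag_fun mul_mx_diag mxE; apply: eq_bigr => k _; rewrite !mxE.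
rewrite E; under eq_fun do rewrite E.
apply: cvg_fin_sum => k; apply: cvgM; last exact: cvg_cst.
by apply: cvgM; [exact: cvg_cst|exact: hc].
Qed.

(** Pi is the projection on the eigenspace of mu along the other eigenspaces,
    and S l is the inverse of A - l on the sum of these, extended by 0. Unlike
    the resolvent, S has no pole at mu. *)
Lemma diagonalizable_resolvent (R : realType) N (A : 'M[R]_N) mu :
  diagonalizable A ->
  exists (Pi : 'M[R]_N) (S : R -> 'M[R]_N),
  [/\ Pi *m Pi = Pi,
      (A - mu%:M) *m Pi = 0, Pi *m (A - mu%:M) = 0,
      \forall l \near mu, (A - l%:M) *m S l = 1%:M - Pi /\
                          S l *m (A - l%:M) = 1%:M - Pi &
      forall i j, S l i j @[l --> mu] --> S mu i j].
Proof.
case=> P Pu /(similar_diagLR Pu)[D AE].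
pose d k := D 0 k.
have {}AE : A = diag_fun P d.
  rewrite AE conjVmx// /diag_fun; congr (_ *m diag_mx _ *m _).
  by apply/rowP => k; rewrite mxE.
have AlE l : A - l%:M = diag_fun P (fun k => d k - l).
  by rewrite diag_funB diag_fun_cst// -AE.
pose p k : R := (d k == mu)%:R.
pose s l k : R := if d k == mu then 0 else (d k - l)^-1.
exists (diag_fun P p), (fun l => diag_fun P (s l)).
have ext f g : f =1 g -> diag_fun P f = diag_fun P g by move=> /funext ->.
have oneB : 1%:M - diag_fun P p = diag_fun P (fun k => 1 - p k).
  by rewrite diag_funB diag_fun_cst.
split.
- rewrite diag_funM//; apply: ext => k; rewrite /p.
  by case: eqP => _; rewrite ?mulr1 ?mulr0.
- rewrite AlE diag_funM// -(scale0r 1%:M) scalemx1 -(diag_fun_cst _ Pu).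
  apply: ext => k; rewrite /p.
  by case: eqP => [->|_]; rewrite ?subrr ?mulr0 ?mul0r.
- rewrite AlE diag_funM// -(scale0r 1%:M) scalemx1 -(diag_fun_cst _ Pu).
  apply: ext => k; rewrite /p.
  by case: eqP => [->|_]; rewrite ?subrr ?mulr0 ?mul0r.
- have : \forall l \near mu, forall k, d k != mu -> d k != l.
    have := @filter_forall R 'I_N
      (fun k l => d k != mu -> d k != l) (nbhs mu) _.
    apply=> k; have [dk|dk] := eqVneq (d k) mu.
      by apply: nearW.
    near=> l => _; rewrite eq_sym; near: l.
    by apply: (open_nbhs_nbhs _); split; [exact: open_neq|rewrite /= eq_sym].
  apply: filterS => l dl.
  rewrite AlE oneB !diag_funM//; split; apply: ext => k; rewrite /p /s.
    case: eqVneq => [_|/dl dk]; first by rewrite mulr0 subrr.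
    by rewrite subr0 mulfV// subr_eq0.
  case: eqVneq => [_|/dl dk]; first by rewrite mul0r subrr.
  by rewrite subr0 mulVf// subr_eq0.
- move=> i j; apply: cvg_diag_fun => k; rewrite /s.
  have [_|dk] := eqVneq (d k) mu; first exact: cvg_cst.
  apply: cvgV; first by rewrite subr_eq0.
  by apply: cvgB; [exact: cvg_cst|exact: cvg_id].
Unshelve. all: by end_near.
Qed.
(** * The rank-one perturbed equation *)

Lemma mem_nullspace (R : realType) N (M : 'M[R]_N) x :
  (x \in nullspace M) = (M *m x == 0).
Proof. by rewrite memv_ker lfunE. Qed.

Lemma shifted_mxE (R : realType) N (A : 'M[R]_N) gamma l x0 x :
  shifted_mx A gamma l x0 *m x =
  (A - l%:M) *m x + ((gamma + l) * bform 1%:M x0 x) *: x0.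
Proof.
rewrite /shifted_mx mulmxDl -scalemxAl -mulmxA [x0^T *m x]mx11_scalar.
by rewrite mul_mx_scalar scalerA /bform mulmx1.
Qed.

(** The multiple y of Pi x0 for which x0^T y = gamma / (gamma + mu). *)
Definition eigenprojection_limit (R : realType) N (Pi : 'M[R]_N) mu gamma x0
    : 'cV[R]_N :=
  (gamma / ((gamma + mu) * bform Pi x0 x0)) *: (Pi *m x0).

(** Applying Pi to the equation kills the term (A - mu) x and gives
    x0^T x = gamma / (gamma + mu), since Pi x0 != 0; the equation then says
    (A - mu) x = 0.  On the eigenline the value of x0^T x determines x. *)
Lemma eigenline_solution (R : realType) N (A Pi S : 'M[R]_N) mu gamma x0 :
  (A - mu%:M) *m Pi = 0 -> Pi *m (A - mu%:M) = 0 ->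
  S *m (A - mu%:M) = 1%:M - Pi ->
  gamma != 0 -> gamma + mu != 0 -> bform Pi x0 x0 != 0 ->
  \dim (nullspace (A - mu%:M)) = 1%N ->
  exists xt, unique_nonzero_solution A gamma mu x0 xt /\ eigenvector A mu xt.
Proof.
move=> BP PB SB g0 gm0 a0 dim1.
set a := bform Pi x0 x0 in a0.
have y0 : Pi *m x0 != 0.
  by apply: contra_neq a0 => y0; rewrite /a -bform_mulmx y0 /bform mulmx0 mxE.
pose xt := eigenprojection_limit Pi mu gamma x0.
have c0 : gamma / ((gamma + mu) * a) != 0.
  by rewrite mulf_neq0 ?invr_eq0 ?mulf_neq0.
have Bxt : (A - mu%:M) *m xt = 0 by rewrite -scalemxAr mulmxA BP mul0mx scaler0.
have xt0 : xt != 0 by rewrite scaler_eq0 negb_or c0.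
exists xt; split; last first.
  by split=> //; apply/eqP; rewrite -subr_eq0 -mul_scalar_mx -mulmxBl Bxt.
split.
  split=> //; rewrite shifted_mxE Bxt add0r; congr (_ *: _).
  by rewrite bformZr bform_mulmx -/a; field; rewrite a0 gm0.
move=> x [_]; rewrite shifted_mxE => eqx.
have xs : (gamma + mu) * bform 1%:M x0 x = gamma.
  have /eqP := congr1 (mulmx Pi) eqx.
  rewrite mulmxDr mulmxA PB mul0mx add0r -!scalemxAr -subr_eq0 -scalerBl.
  by rewrite scaler_eq0 (negbTE y0) orbF subr_eq0 => /eqP.
have Bx : (A - mu%:M) *m x = 0.
  by move: eqx; rewrite xs => /eqP; rewrite -subr_eq0 addrK => /eqP.
have nullE : nullspace (A - mu%:M) = <[Pi *m x0]>%VS.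
  apply/esym/eqP; rewrite eqEdim dim1 dim_vline y0 andbT.
  by rewrite -memvE mem_nullspace mulmxA BP mul0mx.
have : x \in nullspace (A - mu%:M) by rewrite mem_nullspace Bx.
rewrite nullE => /vlineP[k xE]; rewrite /xt xE; congr (_ *: _).
move: xs; rewrite xE bformZr bform_mulmx -/a => xs; rewrite -{1}xs.
by field; rewrite a0 gm0.
Qed.

(** The Sherman-Morrison formula, V being the inverse of M. *)
Lemma rank_one_solution (R : realType) N (M V : 'M[R]_N) c gamma x0 x :
  M *m V = 1%:M -> 1 + c * bform V x0 x0 != 0 ->
  M *m x + (c * bform 1%:M x0 x) *: x0 = gamma *: x0 <->
  x = (gamma / (1 + c * bform V x0 x0)) *: (V *m x0).
Proof.
move=> MV d0; have VM := mulmx1C MV; split=> [eqx|->]; last first.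
  rewrite -scalemxAr mulmxA MV mul1mx bformZr bform_mulmx -scalerDl.
  by congr (_ *: _); field.
set s := gamma - c * bform 1%:M x0 x.
have xE : x = s *: (V *m x0).
  have Mx : M *m x = s *: x0 by rewrite /s scalerBl -eqx addrK.
  by rewrite scalemxAr -Mx mulmxA VM mul1mx.
rewrite xE; congr (_ *: _).
have : s = gamma - c * (s * bform V x0 x0).
  by rewrite {1}/s {1}xE bformZr bform_mulmx.
move=> sE; apply: (mulIf d0); rewrite divfK//.
by rewrite mulrDr mulr1 {1}sE; ring.
Qed.

(** For l near mu, but distinct from it, A - l has inverse S l - Pi / (l - mu).
    By the rank-one formula the solution is
      (gamma / D l) (Pi x0 - (l - mu) S l x0),
      D l = (gamma + l) (a - (l - mu) x0^T S l x0) - (l - mu),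
    with a = x0^T Pi x0.  It is continuous up to l = mu, and the difference
    with its limit can be divided by l - mu explicitly.  Applying A - mu to the
    quotient g mu leaves - (gamma / D mu) (1 - Pi) x0. *)
Lemma perturbed_solution (R : realType) N (A Pi : 'M[R]_N) (S : R -> 'M[R]_N)
    mu gamma x0 :
  (A - mu%:M) *m Pi = 0 ->
  (\forall l \near mu, (A - l%:M) *m S l = 1%:M - Pi) ->
  (forall i j, S l i j @[l --> mu] --> S mu i j) ->
  gamma != 0 -> gamma + mu != 0 -> bform Pi x0 x0 != 0 ->
  exists g : R -> 'cV[R]_N,
  [/\ \forall l \near mu^', unique_nonzero_solution A gamma l x0
        (eigenprojection_limit Pi mu gamma x0 + (l - mu) *: g l),
      forall i, g l i 0 @[l --> mu] --> g mu i 0 &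
      g mu = 0 -> (1%:M - Pi) *m x0 = 0].
Proof.
move=> BP near_BS Sc g0 gm0 a0.
set a := bform Pi x0 x0 in a0 *.
have x00 : x0 != 0.
  by apply: contra_neq a0 => x00; rewrite /a /bform x00 mulmx0 mxE.
pose b l := bform (S l) x0 x0.
pose D l := (gamma + l) * (a - (l - mu) * b l) - (l - mu).
pose g l : 'cV[R]_N :=
  (gamma * ((gamma + l) * b l + 1 - a) / (D l * ((gamma + mu) * a))) *:
    (Pi *m x0) - (gamma / D l) *: (S l *m x0).
have Sxc i : (S l *m x0) i 0 @[l --> mu] --> (S mu *m x0) i 0.
  have E l : (S l *m x0) i 0 = \sum_j S l i j * x0 j 0 by rewrite mxE.
  rewrite E; under eq_fun do rewrite E.
  by apply: cvg_fin_sum => j; apply: cvgM; [exact: Sc|exact: cvg_cst].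
have bc : b l @[l --> mu] --> b mu.
  have E l : b l = \sum_i x0 i 0 * (S l *m x0) i 0.
    by rewrite /b /bform -mulmxA mxE; apply: eq_bigr => i _; rewrite mxE.
  rewrite E; under eq_fun do rewrite E.
  by apply: cvg_fin_sum => i; apply: cvgM; [exact: cvg_cst|exact: Sxc].
have idc : l @[l --> mu] --> mu by exact: cvg_id.
have Dmu : D mu = (gamma + mu) * a by rewrite /D; ring.
have Dmu0 : D mu != 0 by rewrite Dmu mulf_neq0.
have Dc : D l @[l --> mu] --> D mu.
  apply: cvgB; last by apply: cvgB => //; exact: cvg_cst.
  apply: cvgM; first by apply: cvgD => //; exact: cvg_cst.
  apply: cvgB; first exact: cvg_cst.
  by apply: cvgM => //; apply: cvgB => //; exact: cvg_cst.
have near_D : \forall l \near mu, D l != 0.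
  exact: cvgr_neq0 Dc Dmu0.
exists g; split.
- have near_BS' : \forall l \near mu^', (A - l%:M) *m S l = 1%:M - Pi.
    exact: nbhs_dnbhs near_BS.
  have near_D' : \forall l \near mu^', D l != 0 by exact: nbhs_dnbhs near_D.
  near=> l.
  have BS : (A - l%:M) *m S l = 1%:M - Pi by near: l.
  have Dl : D l != 0 by near: l.
  have lmu : l - mu != 0 by rewrite subr_eq0; near: l; exact: nbhs_dnbhs_neq.
  pose V := S l - (l - mu)^-1 *: Pi.
  have MV : (A - l%:M) *m V = 1%:M.
    have AlE : A - l%:M = (A - mu%:M) - (l - mu)%:M.
      by rewrite raddfB /= opprB addrA subrK.
    rewrite /V mulmxBr BS -scalemxAr AlE mulmxBl BP mul_scalar_mx sub0r.
    by rewrite scalerN scalerA mulVf// scale1r opprK subrK.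
  have VE : bform V x0 x0 = b l - (l - mu)^-1 * a.
    by rewrite /V /b /a /bform mulmxBr mulmxBl -scalemxAr -scalemxAl !mxE.
  have dE : 1 + (gamma + l) * bform V x0 x0 = - (D l / (l - mu)).
    by rewrite VE /D; field.
  have d0 : 1 + (gamma + l) * bform V x0 x0 != 0.
    by rewrite dE oppr_eq0 mulf_neq0 ?invr_eq0.
  have solE x : shifted_mx A gamma l x0 *m x = gamma *: x0 <->
      x = eigenprojection_limit Pi mu gamma x0 + (l - mu) *: g l.
    rewrite shifted_mxE (rank_one_solution gamma x MV d0).
    suff -> : (gamma / (1 + (gamma + l) * bform V x0 x0)) *: (V *m x0) =
        eigenprojection_limit Pi mu gamma x0 + (l - mu) *: g l by [].
    rewrite dE /V /g /eigenprojection_limit mulmxBl -scalemxAl.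
    rewrite -/a /D; move: (Pi *m x0) (S l *m x0) Dl => y z Dl.
    apply/matrixP => i j; rewrite !mxE; field.
    by rewrite -/(D l) Dl lmu a0 gm0.
  split; first split; last by move=> x [_ /solE ->].
    apply: contra_neq x00 => xl0.
    have /solE : eigenprojection_limit Pi mu gamma x0 + (l - mu) *: g l =
      eigenprojection_limit Pi mu gamma x0 + (l - mu) *: g l by [].
    by rewrite xl0 mulmx0 => /esym/eqP; rewrite scaler_eq0 (negbTE g0) => /eqP.
  exact/solE.
- move=> i.
  have E l : g l i 0 =
      gamma * ((gamma + l) * b l + 1 - a) / (D l * ((gamma + mu) * a)) *
        (Pi *m x0) i 0 - gamma / D l * (S l *m x0) i 0.
    by rewrite /g; move: (Pi *m x0) (S l *m x0) => y z; rewrite !mxE.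
  rewrite E; under eq_fun do rewrite E.
  apply: cvgB; last first.
    apply: cvgM => //; apply: cvgM; first exact: cvg_cst.
    exact: cvgV.
  apply: cvgM; last exact: cvg_cst.
  apply: cvgM; last first.
    apply: cvgV; first by rewrite mulf_neq0// mulf_neq0.
    by apply: cvgM => //; exact: cvg_cst.
  apply: cvgM; first exact: cvg_cst.
  apply: cvgB; last exact: cvg_cst.
  apply: cvgD; last exact: cvg_cst.
  by apply: cvgM => //; apply: cvgD => //; exact: cvg_cst.
- move=> gmu0; have := congr1 (mulmx (A - mu%:M)) gmu0.
  rewrite /g mulmxBr -!scalemxAr !mulmxA BP mul0mx scaler0 sub0r mulmx0.
  rewrite (nbhs_singleton near_BS) => /eqP.
  rewrite oppr_eq0 scaler_eq0 mulf_eq0 invr_eq0 (negbTE g0) (negbTE Dmu0).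
  by move=> /eqP.
Unshelve. all: by end_near.
Qed.
(** * Euclidean norm estimates *)

Lemma enormZ (R : realType) N (a : R) (x : 'cV[R]_N) :
  enorm (a *: x) = `|a| * enorm x.
Proof.
rewrite /enorm -sqrtr_sqr -sqrtrM ?sqr_ge0// mulr_sumr; congr Num.sqrt.
by apply: eq_bigr => i _; rewrite mxE exprMn.
Qed.

Lemma le_coord_enorm (R : realType) N (x : 'cV[R]_N) i : `|x i 0| <= enorm x.
Proof.
rewrite /enorm -sqrtr_sqr ler_wsqrtr// (bigD1 i)//= lerDl.
by apply: sumr_ge0 => j _; exact: sqr_ge0.
Qed.

Lemma enorm_eq0 (R : realType) N (x : 'cV[R]_N) : enorm x = 0 -> x = 0.
Proof.
move=> x0; apply/matrixP => i j; rewrite ord1 mxE; apply/eqP.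
by rewrite -normr_eq0 eq_le normr_ge0 andbT -x0 le_coord_enorm.
Qed.

Lemma cvg_enorm (R : realType) N (g : R -> 'cV[R]_N) mu :
  (forall i, g l i 0 @[l --> mu] --> g mu i 0) ->
  enorm (g l) @[l --> mu] --> enorm (g mu).
Proof.
move=> gc; have sqc : \sum_i g l i 0 ^+ 2 @[l --> mu] --> \sum_i g mu i 0 ^+ 2.
  by apply: cvg_fin_sum => i; apply: cvgM; exact: gc.
exact: (cvg_comp _ _ sqc (@sqrt_continuous _ _)).
Qed.

(** This makes the limit point unique: two candidates are within a multiple of
    |l - mu| of the same solution. *)
Lemma near_linear_bound_eq0 (R : realType) (p C mu : R) :
  (\forall l \near mu^', `|p| <= C * `|l - mu|) -> p = 0.
Proof.
move=> pC; apply/eqP; rewrite -normr_eq0; apply: contraT => p0.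
have Clim : C * `|l - mu| @[l --> mu] --> C * `|mu - mu|.
  apply: cvgM; first exact: cvg_cst.
  by apply: cvg_norm; apply: cvgB; [exact: cvg_id|exact: cvg_cst].
have : \forall l \near mu^', C * `|l - mu| < `|p|.
  apply: nbhs_dnbhs; apply: cvgr_lt Clim _ _.
  by rewrite subrr normr0 mulr0 lt_neqAle eq_sym p0 normr_ge0.
move=> Cp; have [l [/le_lt_trans H /H]] := filter_ex (filterI pC Cp).
by rewrite ltxx.
Qed.

(** * The theorem *)

Theorem proposition2 (R : realType) (N : nat) (A : 'M[R]_N)
    (lambdat gamma : R) (sigma : probability (borel_cV R N) R) :
  diagonalizable A ->
  eigenvalue A lambdat ->
  0 < gamma ->
  gamma <> - lambdat ->
  uniform_on_sphere sigma ->
  (\dim (nullspace (A - lambdat%:M)) = 1%N ->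
   \forall x0 \ae sigma,
     exists xt : 'cV[R]_N,
       unique_nonzero_solution A gamma lambdat x0 xt /\
       eigenvector A lambdat xt) /\
  ((1 < \dim (nullspace (A - lambdat%:M)))%N ->
   \forall x0 \ae sigma,
     exists! xt : 'cV[R]_N,
       xt \in nullspace (A - lambdat%:M) /\
       exists eta1 eta2 : R,
         [/\ 0 < eta1, eta1 < eta2 &
          \forall lambda \near lambdat^',
            exists xl : 'cV[R]_N,
              [/\ unique_nonzero_solution A gamma lambda x0 xl,
                  A != lambdat%:M ->
                    eta1 * `|lambda - lambdat| < enorm (xl - xt) &
                  enorm (xl - xt) < eta2 * `|lambda - lambdat| ]]).
Proof.
move=> diagA eigA gamma_gt0 gamma_neq sigma_unif.
have g0 : gamma != 0 by rewrite gt_eqF.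
have gm0 : gamma + lambdat != 0 by apply/eqP => /eqP; rewrite addr_eq0 => /eqP.
have [Pi [S [PiPi BPi PiB near_BS Sc]]] :=
  diagonalizable_resolvent lambdat diagA.
have [BS SB] := nbhs_singleton near_BS.
have Pi0 : Pi != 0.
  have /eigenvalueP[v vA v0] := eigA.
  apply: contra_neq v0 => Pi0; have := congr1 (mulmx v) BS.
  by rewrite mulmxA mulmxBr vA mul_mx_scalar subrr mul0mx Pi0 subr0 mulmx1.
have aeF : Filter (nbhs (almost_everywhere sigma)).
  exact: (ae_filter_ringOfSetsType sigma).
have ae_Pi := ae_idempotent_form_neq0 sigma_unif PiPi Pi0.
split=> [dim1|_].
  apply: (filterS _ ae_Pi) => x0 /= a0.
  exact: (eigenline_solution BPi PiB SB g0 gm0 a0 dim1).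
have ae_E : \forall x0 \ae sigma, A != lambdat%:M -> (1%:M - Pi) *m x0 != 0.
  have [_|AnI] := eqVneq A lambdat%:M; first by apply: nearW.
  have E0 : 1%:M - Pi != 0.
    apply: contra_neq AnI => /eqP; rewrite subr_eq0 => /eqP PiE.
    by move: BPi; rewrite -PiE mulmx1 => /eqP; rewrite subr_eq0 => /eqP.
  have EE : (1%:M - Pi) *m (1%:M - Pi) = 1%:M - Pi.
    by rewrite mulmxBr mulmx1 mulmxBl mul1mx PiPi subrr subr0.
  apply: (filterS _ (ae_idempotent_form_neq0 sigma_unif EE E0)) => x0 /= + _.
  by apply: contra_neq => Ex0; rewrite -bform_mulmx Ex0 /bform mulmx0 mxE.
apply: (filterS2 _ _ ae_Pi ae_E) => x0 /= a0 Ex0.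
have near_BS1 : \forall l \near lambdat, (A - l%:M) *m S l = 1%:M - Pi.
  by apply: (filterS _ near_BS) => l [].
have [g [sol gc gmu]] := perturbed_solution BPi near_BS1 Sc g0 gm0 a0.
set xt := eigenprojection_limit Pi lambdat gamma x0 in sol *.
have enc := cvg_enorm gc; set n := enorm (g lambdat) in enc.
have n0 : 0 <= n by exact: sqrtr_ge0.
(* If A = lambdat%:M then n may be 0, and any eta1 < eta2 will do. *)
pose eta1 := if n == 0 then 2^-1 else n / 2.
have up : \forall l \near lambdat^', enorm (g l) < n + 1.
  by apply: nbhs_dnbhs; apply: cvgr_lt enc _ _; lra.
have low : \forall l \near lambdat^', A != lambdat%:M -> eta1 < enorm (g l).
  have [_|AnI] := eqVneq A lambdat%:M; first by apply: nearW.
  have nN : n != 0 by apply: contra_neq (Ex0 AnI) => /enorm_eq0; exact: gmu.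
  have : \forall l \near lambdat^', n / 2 < enorm (g l).
    by apply: nbhs_dnbhs; apply: cvgr_gt enc _ _; lra.
  by apply: filterS => l; rewrite /eta1 (negbTE nN).
exists xt; split.
  split; first by rewrite mem_nullspace -scalemxAr mulmxA BPi mul0mx scaler0.
  exists eta1, (n + 1); split.
  - rewrite /eta1; case: eqP => [_|/eqP n0']; first by rewrite invr_gt0.
    by rewrite divr_gt0// lt_neqAle eq_sym n0'.
  - by rewrite /eta1; case: eqP => _; lra.
  near=> l; exists (xt + (l - lambdat) *: g l).
  have lmu : 0 < `|l - lambdat|.
    by rewrite normr_gt0 subr_eq0; near: l; exact: nbhs_dnbhs_neq.
  rewrite [X in enorm X](_ : _ = (l - lambdat) *: g l); last first.
    by rewrite addrC addKr.
  rewrite enormZ; split; first by near: l.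
    by move=> AnI; rewrite mulrC ltr_pM2l//; move: AnI; near: l.
  by rewrite mulrC ltr_pM2r//; near: l.
move=> y [_ [e1 [e2 [e1_gt0 e12 near_y]]]].
apply/matrixP => i j; rewrite ord1 {j}; apply/eqP; rewrite -subr_eq0; apply/eqP.
apply: (@near_linear_bound_eq0 _ _ (n + 1 + e2) lambdat).
near=> l; set d := `|_ - _|.
have [xl [[_ xlU] _ xly]] : exists xl : 'cV[R]_N,
  [/\ unique_nonzero_solution A gamma l x0 xl,
     A != lambdat%:M -> e1 * `|l - lambdat| < enorm (xl - y) &
     enorm (xl - y) < e2 * `|l - lambdat| ] by near: l.
have [solx _] :
  unique_nonzero_solution A gamma l x0 (xt + (l - lambdat) *: g l) by near: l.
have xlE := xlU _ solx.
have gl : enorm (g l) < n + 1 by near: l.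
have -> : d = `|(xl - y) i 0 - ((l - lambdat) *: g l) i 0|.
  by rewrite /d xlE; congr `|_|; rewrite !mxE; ring.
rewrite (le_trans (ler_normB _ _))// mulrDl addrC lerD//.
  rewrite (le_trans (le_coord_enorm _ _))// enormZ mulrC.
  by rewrite ler_wpM2r// ltW.
by rewrite (le_trans (le_coord_enorm _ _))// ltW.
Unshelve. all: by end_near.
Qed.
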